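(* Let $d\ge 1$ be an integer and let $\{X_{\mathbf n};\ \mathbf n\in\mathbb N^d\}$ be a negatively associated field of identically distributed random variables. If $$\mathbb P\Big(\limsup_{\mathbf n\to\infty}\frac{|S_{\mathbf n}|}{(2d|\mathbf n|\log\log|\mathbf n|)^{1/2}}<\infty\Big)>0,$$ then $\mathbb E X_{\mathbf 1}=0$ and $\mathbb E\big[X_{\mathbf 1}^2\log^{d-1}(|X_{\mathbf 1}|)/\log\log(|X_{\mathbf 1}|)\big]<\infty$.
   Context: A finite family $\{X_i;1\le i\le n\}$ of random variables is negatively associated if for every pair of disjoint subsets $A,B\subset\{1,\dots,n\}$, $\operatorname{Cov}(f(X_i;i\in A),g(X_j;j\in B))\le 0$ whenever $f,g$ are coordinatewise non-decreasing and the covariance exists; an infinite family is negatively associated if every finite subfamily is. For $\mathbf n=(n_1,\dots,n_d)\in\mathbb N^d$, $|\mathbf n|=n_1\cdots n_d$; $\mathbf k\le\mathbf n$ means $k_i\le n_i$ for all $i$; $\mathbf 1=(1,\dots,1)$; $S_{\mathbf n}=\sum_{\mathbf k\le\mathbf n}X_{\mathbf k}$; $\mathbf n\to\infty$ means $n_1\to\infty,\dots,n_d\to\infty$. Throughout, $\log x=\ln(x\vee e)$. *)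

(* Defs.v *)
From HB Require Import structures.
From mathcomp Require Import all_boot all_order all_algebra.
From mathcomp Require Import all_classical all_reals all_analysis.
Set Implicit Arguments. Unset Strict Implicit. Unset Printing Implicit Defensive.
Import Order.TTheory GRing.Theory Num.Theory.
Import numFieldNormedType.Exports.
Local Open Scope classical_set_scope.
Local Open Scope ring_scope.

(* multi-indices n = (n_1,...,n_dim) in N^dim (N = {1,2,...}) *)
Definition idx (dim : nat) := {ffun 'I_dim -> nat}.

Definition pos_idx dim (n : idx dim) : Prop := forall i, (1 <= n i)%N.

Definition one_idx dim : idx dim := [ffun => 1%N].

Definition idx_card dim (n : idx dim) : nat := (\prod_(i < dim) n i)%N.

Definition Log (R : realType) (x : R) : R := ln (Num.max x (expR 1)).
Definition LogLog (R : realType) (x : R) : R := Log (Log x).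

Definition idx_max dim (n : idx dim) : nat := (\max_(i < dim) n i)%N.

Definition partial_sum (R : realType) (T : Type) dim
    (X : idx dim -> T -> R) (n : idx dim) (w : T) : R :=
  \sum_(k : {ffun 'I_dim -> 'I_(idx_max n).+1} |
          [forall i, (0 < k i)%N && (k i <= n i)%N])
    X [ffun i => nat_of_ord (k i)] w.

Definition idx_to_infty dim : set (set (idx dim)) :=
  [set V | exists N : nat, [set n : idx dim | forall i, (N <= n i)%N] `<=` V].

(* limsup along a filter F (literal unfolding of limf_esup) *)
Definition limsup_along (R : realType) (I : Type) (f : I -> \bar R)
    (F : set (set I)) : \bar R :=
  ereal_inf [set ereal_sup (f @` V) | V in F].

Definition coord_nondecr (R : realType) m (f : ('I_m -> R) -> R) : Prop :=
  forall u v : 'I_m -> R, (forall i, u i <= v i) -> f u <= f v.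

Definition negatively_associated d0 (T : measurableType d0) (R : realType)
    (P : probability T R) dim (X : idx dim -> {RV P >-> R}) : Prop :=
  forall (m k : nat) (a : 'I_m -> idx dim) (b : 'I_k -> idx dim),
    injective a -> injective b ->
    (forall i j, a i <> b j) ->
    (forall i, pos_idx (a i)) -> (forall j, pos_idx (b j)) ->
    forall (f : ('I_m -> R) -> R) (g : ('I_k -> R) -> R),
      coord_nondecr f -> coord_nondecr g ->
      let F := fun w => f (fun i => X (a i) w) in
      let G := fun w => g (fun j => X (b j) w) in
      F \in Lfun P 1 -> G \in Lfun P 1 -> (F * G)%R \in Lfun P 1 ->
      (covariance P F G <= 0)%E.

Definition identically_distributed d0 (T : measurableType d0) (R : realType)
    (P : probability T R) dim (X : idx dim -> {RV P >-> R}) : Prop :=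
  forall n m : idx dim, pos_idx n -> pos_idx m ->
    forall A : set R, measurable A ->
      distribution P (X n) A = distribution P (X m) A.

(* Main.v *)
Require Import Defs.
From HB Require Import structures.
From mathcomp Require Import all_boot all_order all_algebra.
From mathcomp Require Import all_classical all_reals all_analysis.
From mathcomp Require Import measurable_realfun.
From mathcomp Require Import ring lra zify.
Set Implicit Arguments. Unset Strict Implicit. Unset Printing Implicit Defensive.
Import Order.TTheory GRing.Theory Num.Theory.
Import numFieldNormedType.Exports.
Local Open Scope classical_set_scope.
Local Open Scope ring_scope.

(** Inclusion-exclusion over the corners of a unit cube recovers [X_n] from the
    partial sums, so that on an event [A] of positive probability
    [|X_n| <= K * sqrt (|n| LogLog |n|)] for all [n] with large coordinates.
    Indicators of upper (or lower) tails are monotone transforms, hence pairwise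
    negatively correlated, and a second-moment argument gives
    [P A * \sum_n P (|X_1| > K sqrt (|n| LogLog |n|)) <= 2].  The number of [n]
    with all coordinates larger than [N] and [K sqrt (|n| LogLog |n|) < x] is at
    least of order [x^2 Log^(d-1) x / LogLog x], which yields the moment bound.
    Finally, a weak law for the truncated variables shows that [S_n / |n|] is
    close to the mean with high probability, whereas it is close to [0] on [A]. *)

(** * Iterated logarithms *)

Section Log.
Variable R : realType.
Implicit Types x y a : R.

Lemma Log_ge1 x : 1 <= Log x.
Proof.
rewrite /Log -[leLHS](expRK 1) ler_ln ?posrE ?expR_gt0 ?lt_max ?expR_gt0 ?orbT//.
by rewrite le_max lexx orbT.
Qed.

Lemma Log_gt0 x : 0 < Log x.
Proof. exact: lt_le_trans (Log_ge1 x). Qed.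

Lemma LogLog_ge1 x : 1 <= LogLog x.
Proof. exact: Log_ge1. Qed.

Lemma LogLog_gt0 x : 0 < LogLog x.
Proof. exact: Log_gt0. Qed.

Lemma le_Log x y : x <= y -> Log x <= Log y.
Proof.
move=> xy; rewrite /Log ler_ln ?posrE ?lt_max ?expR_gt0 ?orbT//.
by rewrite ge_max !le_max xy lexx orbT.
Qed.

Lemma le_LogLog x y : x <= y -> LogLog x <= LogLog y.
Proof. by move=> xy; apply/le_Log/le_Log. Qed.

Lemma LogE x : expR 1 <= x -> Log x = ln x.
Proof. by move=> ex; rewrite /Log max_l. Qed.

Lemma ln_le_Log x : ln x <= Log x.
Proof.
have [x0|x0] := leP x 0; first by rewrite ln0// ltW// Log_gt0.
by rewrite /Log ler_ln ?posrE ?lt_max ?x0 // le_max lexx.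
Qed.

Lemma ln_leB1 x : 0 < x -> ln x <= x - 1.
Proof. by move=> x0; rewrite -[in leLHS](subrKC 1 x) le_ln1Dx//; lra. Qed.

Lemma Log_le x : 1 <= x -> Log x <= x.
Proof.
move=> x1; rewrite /Log; have [xe|ex] := leP x (expR 1); first by rewrite expRK.
by apply: le_trans (ln_leB1 _) _; lra.
Qed.

Lemma Log_sqr_le x : 0 <= x -> Log (x ^+ 2) <= 2 * Log x.
Proof.
move=> x0; have [ex|xe] := leP (expR 1) (x ^+ 2); last first.
  by rewrite {1}/Log max_r ?ltW// expRK; have := Log_ge1 x; lra.
have {}x0 : 0 < x.
  rewrite lt_neqAle x0 andbT; apply: contraTneq ex => <-.
  by rewrite expr0n/= -ltNge expR_gt0.
by rewrite LogE// lnXn//; have := ln_le_Log x; lra.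
Qed.

Lemma Log_double_le x : Log (2 * x) <= 2 * Log x.
Proof.
have e1 := expR_ge1Dx (1 : R).
have m0 : 0 < Num.max x (expR 1) by rewrite lt_max expR_gt0 orbT.
apply: (@le_trans _ _ (ln (2 * Num.max x (expR 1)))).
  rewrite /Log ler_ln ?posrE ?lt_max ?expR_gt0 ?orbT ?mulr_gt0//.
  rewrite ge_max ler_pM2l// le_max lexx/=.
  apply: (@le_trans _ _ (Num.max x (expR 1))); first by rewrite le_max lexx orbT.
  by lra.
rewrite lnM ?posrE// -/(Log x).
by have := ln_leB1 (ltr0n R 2); have := Log_ge1 x; lra.
Qed.

Lemma LogLog_sqr_le x : 0 <= x -> LogLog (x ^+ 2) <= 2 * LogLog x.
Proof.
by move=> x0; rewrite (le_trans (le_Log (Log_sqr_le x0)))// Log_double_le.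
Qed.

(** With [s = sqrt x], [LogLog x <= Log x = 2 * ln s <= 2 * s], and this is at most [a * s ^+ 2]
    once [x >= 4 / a ^+ 2]. The summand [expR 1] in the witness makes [Log x] the genuine
    logarithm. *)
Lemma LogLog_le_linear a : 0 < a ->
  exists2 x0, 1 <= x0 & forall x, x0 <= x -> LogLog x <= a * x.
Proof.
move=> a0; exists (expR 1 + 4 / a ^+ 2).
  have := expR_ge1Dx (1 : R).
  have : 0 < 4 / a ^+ 2 by rewrite divr_gt0// exprn_gt0.
  by lra.
move=> x xx0.
have e1 := expR_ge1Dx (1 : R).
have c0 : 0 < 4 / a ^+ 2 by rewrite divr_gt0// exprn_gt0.
have x0 : 0 < x by lra.
rewrite /LogLog (le_trans (Log_le (Log_ge1 _)))// LogE; last by lra.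
have s0 : 0 < Num.sqrt x by rewrite sqrtr_gt0.
rewrite -[in leLHS](sqr_sqrtr (ltW x0)) lnXn//.
have := ln_leB1 s0; set s := Num.sqrt x in s0 * => lns.
have xs : x = s ^+ 2 by rewrite sqr_sqrtr// ltW.
suff : 2 <= a * s by rewrite xs => h; nra.
rewrite -(@ler_pXn2r _ 2) ?nnegrE ??ler0n ?mulr_ge0 ?(ltW a0) ?(ltW s0)//.
have h : 4 / a ^+ 2 <= x by lra.
rewrite ler_pdivrMr ?exprn_gt0// in h.
by rewrite exprMn -xs; lra.
Qed.

Lemma measurable_Log : measurable_fun [set: R] (@Log R).
Proof.
by apply: measurableT_comp => //; apply: measurable_maxr.
Qed.

End Log.

(** * Harmonic sums and counting multiples *)

Lemma harmonic_ge_ln (R : realType) n :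
  ln (n.+1%:R : R) <= \sum_(j < n) (j.+1%:R)^-1.
Proof.
elim: n => [|n ih]; first by rewrite big_ord0 ln1.
rewrite big_ord_recr/=.
have -> : n.+2%:R = n.+1%:R * (1 + n.+1%:R^-1) :> R.
  by rewrite mulrDr mulr1 divff ?pnatr_eq0// -natr1.
have p0 : 0 < n.+1%:R^-1 :> R by rewrite invr_gt0.
rewrite lnM ?posrE ?addr_gt0//.
by rewrite lerD// le_ln1Dx// (lt_trans _ p0)// ltrN10.
Qed.

(** Each of the first [Y %/ p] values of [a] contributes one; [Y <= L] ensures that they all lie in
    the range of summation. *)
Lemma count_mul_le (L Y p : nat) : (0 < p)%N -> (Y <= L)%N ->
  (Y %/ p <= \sum_(a < L) ((p * a.+1 <= Y)%N : nat))%N.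
Proof.
move=> p0 YL.
have ql : (Y %/ p <= L)%N by rewrite (leq_trans (leq_div _ _)).
rewrite -(subnKC ql) big_split_ord/= -[leqLHS]addn0 leq_add//.
rewrite -[leqLHS]card_ord -sum1_card leq_sum// => i _.
by rewrite mulnC -leq_divRL// ltn_ord.
Qed.
(** * Counting lattice points under a hyperboloid *)

(** Peels off the coordinate [ord0], so that lattice points can be counted along one axis while the
    other coordinates stay fixed. *)
Lemma sum_ffun_recl (V : nmodType) d (J : finType)
    (F : {ffun 'I_d.+1 -> J} -> V) :
  \sum_f F f = \sum_(g : {ffun 'I_d -> J}) \sum_(a : J)
    F [ffun i => oapp g a (unlift ord0 i)].
Proof.
rewrite pair_big/=.
pose cons (p : {ffun 'I_d -> J} * J) : {ffun 'I_d.+1 -> J} :=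
  [ffun i => oapp p.1 p.2 (unlift ord0 i)].
pose decons (f : {ffun 'I_d.+1 -> J}) : {ffun 'I_d -> J} * J :=
  ([ffun i => f (lift ord0 i)], f ord0).
rewrite (reindex cons)//=; exists decons => [[g a] _|f _].
  rewrite /decons /cons/=; congr pair; last by rewrite ffunE unlift_none.
  by apply/ffunP => i; rewrite !ffunE liftK.
apply/ffunP => i; rewrite ffunE.
by case: unliftP => [j|] -> /=; rewrite ?ffunE.
Qed.

(** Fix the last [d] factors, all at most [r], with product [p <= r ^ d <= Y]. The first factor then
    has at least [Y %/ p] choices, which is at least [Y / (2 * p)], and the sum of [1 / p] over
    these factors is the [d]-th power of a harmonic sum. *)
Lemma count_prod_le (R : realType) d (r Y L : nat) :
  (0 < Y)%N -> (Y <= L)%N -> (r <= L)%N -> (r ^ d <= Y)%N ->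
  Y%:R / 2 * (\sum_(j < r) (j.+1%:R)^-1) ^+ d <=
  \sum_(f : {ffun 'I_d.+1 -> 'I_L}) (\prod_i (f i).+1 <= Y)%N%:R :> R.
Proof.
move=> Y0 YL rL rY; rewrite sum_ffun_recl.
(* Extending the reciprocals by zero lets the power of the harmonic sum expand over the same
   functions into ['I_L] as the count. *)
pose v (j : nat) : R := if (j < r)%N then (j.+1%:R)^-1 else 0.
have -> : \sum_(j < r) (j.+1%:R)^-1 = \sum_(j < L) v j.
  by rewrite (big_ord_widen L (fun j => (j.+1%:R)^-1))// big_mkcond.
rewrite -[X in _ ^+ X](card_ord d) -prodr_const bigA_distr_bigA/= mulr_sumr.
apply: ler_sum => g _.
under [leRHS]eq_bigr => a _.
  rewrite big_ord_recl ffunE unlift_none/=.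
  under eq_bigr do rewrite ffunE liftK/=.
  over.
set p := (\prod_(i < d) (g i).+1)%N.
have [gr|] := boolP [forall i, (g i < r)%N]; last first.
  rewrite negb_forall => /existsP[i gir].
  rewrite (bigD1 i)//= {1}/v (negbTE gir) mul0r mulr0.
  by apply: sumr_ge0.
have {}gr i : (g i < r)%N by move/forallP: gr.
have -> : \prod_i v (g i) = (p%:R)^-1.
  rewrite natr_prod -prodfV; apply: eq_bigr => i _.
  by rewrite /v gr.
have p0 : (0 < p)%N by rewrite prodn_gt0.
have pY : (p <= Y)%N.
  rewrite (leq_trans _ rY)// -[X in (_ <= _ ^ X)%N](card_ord d) -prod_nat_const.
  exact: leq_prod.
have := count_mul_le p0 YL; rewrite -(ler_nat R) natr_sum => h.
under [leRHS]eq_bigr do rewrite mulnC.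
apply: le_trans h.
(* Since [p <= Y] the quotient is at least one, so rounding down loses at most a factor 2. *)
rewrite ler_pdivrMr ?ltr0n// ler_pdivrMr ?ltr0n// -!natrM ler_nat.
rewrite {1}(divn_eq Y p).
have := ltn_pmod Y p0; have : (0 < Y %/ p)%N by rewrite divn_gt0.
by move: (Y %/ p)%N (Y %% p)%N => a b; nia.
Qed.

(* [r] is the integer part of the [d.+1]-th root of [Y], so that [r ^ d <= Y]
   while the harmonic sum up to [r] is at least [ln Y / d.+1]. *)
Lemma count_prod_le_ln (R : realType) d (Y L : nat) :
  (0 < Y)%N -> (Y <= L)%N ->
  Y%:R / 2 * (ln (Y%:R) / d.+1%:R) ^+ d <=
  \sum_(f : {ffun 'I_d.+1 -> 'I_L}) (\prod_i (f i).+1 <= Y)%N%:R :> R.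
Proof.
move=> Y0 YL.
have exr : exists r, (r ^ d.+1 <= Y)%N by exists 0%N; rewrite exp0n.
have ubr r : (r ^ d.+1 <= Y -> r <= Y)%N.
  case: r => [//|r] h; apply: leq_trans h; rewrite expnS.
  by rewrite leq_pmulr// expn_gt0.
case: (ex_maxnP exr ubr) => r rY rmax.
have Yr : (Y < r.+1 ^ d.+1)%N.
  by rewrite ltnNge; apply/negP => /rmax; rewrite ltnn.
have rY' : (r ^ d <= Y)%N.
  case: (posnP r) rY => [->|r0 rY].
    by rewrite (leq_trans _ Y0)//; case: (d) => [|k]; rewrite ?expn0 ?exp0n.
  by rewrite (leq_trans _ rY)// leq_pexp2l.
apply: le_trans (count_prod_le _ Y0 YL (leq_trans (ubr _ rY) YL) rY').
rewrite ler_pM2l ?divr_gt0 ?ltr0n//.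
have lnY0 : 0 <= ln (Y%:R : R) by rewrite ln_ge0// ler1n.
rewrite lerXn2r ?nnegrE ?divr_ge0 ?sumr_ge0// ?ler_pdivrMr ?ltr0n//.
apply: le_trans (ler_wpM2r (ler0n _ _) (harmonic_ge_ln R r)).
rewrite mulr_natr -lnXn ?ltr0n// -natrX.
by rewrite ler_ln ?posrE ?ltr0n ?expn_gt0// ler_nat ltnW.
Qed.

(** * The normalising field, the moment function and their comparison *)

Definition lil_norm (R : realType) dim (n : idx dim) : R :=
  Num.sqrt (2 * dim%:R * (idx_card n)%:R * LogLog ((idx_card n)%:R)).

Definition lil_moment (R : realType) dim (x : R) : R :=
  x ^+ 2 * Log x ^+ (dim - 1) / LogLog x.

(** Parametrises the finite box of indices whose coordinates run from [N + 1] to [N + L]. *)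
Definition shift_idx dim (N L : nat) (m : {ffun 'I_dim -> 'I_L}) : idx dim :=
  [ffun i => (m i + N).+1].

Lemma lil_norm_lt (R : realType) dim (n : idx dim) (K x : R) :
  0 <= K -> 0 < x ->
  2 * dim%:R * K ^+ 2 * ((idx_card n)%:R * LogLog ((idx_card n)%:R)) < x ^+ 2 ->
  K * lil_norm R n < x.
Proof.
move=> K0 x0 h; rewrite -(@ltr_pXn2r _ 2) ?nnegrE ?mulr_ge0 ?sqrtr_ge0 ?(ltW x0)//.
rewrite exprMn sqr_sqrtr; first by apply: le_lt_trans h; lra.
by rewrite !mulr_ge0// ltW// LogLog_gt0.
Qed.

Lemma lil_moment_ge0 (R : realType) dim (x : R) : 0 <= lil_moment dim x.
Proof.
rewrite divr_ge0 ?(ltW (LogLog_gt0 _))// mulr_ge0 ?sqr_ge0//.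
by rewrite exprn_ge0// ltW// Log_gt0.
Qed.

(** Turns a sum of tail probabilities into a moment. The constants are chosen before [J], and only
    the box side [L] depends on it, so the integrated bound is uniform in the truncation level; [c0]
    absorbs small [x]. *)
Lemma lil_moment_le_count (R : realType) dim (N : nat) (K : R) :
  (1 <= dim)%N -> 0 <= K ->
  exists c0 c1 : R, [/\ 0 <= c0, 0 <= c1 & forall J : nat, exists L,
    forall x, 0 <= x <= J%:R -> lil_moment dim x <= c0 +
      c1 * \sum_(m : {ffun 'I_dim -> 'I_L}) (K * lil_norm R (shift_idx N m) < x)%R%:R].
Proof.
case: dim => [//|d] _ K0.
set dim := d.+1.
(* [Q] is the price of the shift: [m_i + N + 1 <= (N + 1) * (m_i + 1)] in each coordinate. *)
pose Q : R := (N.+1 ^ dim)%:R.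
have Q1 : 1 <= Q by rewrite ler1n expn_gt0.
pose K' : R := 2 * dim%:R * K ^+ 2.
have K'0 : 0 <= K' by rewrite !mulr_ge0// exprn_ge0.
pose delta := (Q * (2 * K' + 1))^-1.
have Q0 : 0 < Q by lra.
have QK0 : 0 < Q * (2 * K' + 1) by rewrite mulr_gt0//; lra.
have delta0 : 0 < delta by rewrite invr_gt0.
have Qdelta : Q * delta * (2 * K' + 1) = 1.
  by rewrite mulrAC divff// gt_eqF.
(* Beyond [x0], [LogLog x <= delta / 2 * x], which will give [2 * x <= z] and hence [x <= Y]. *)
have [x0 x0_1 hx0] := LogLog_le_linear (divr_gt0 delta0 (ltr0n R 2)).
pose x1 := Num.max x0 (expR 1).
exists (x1 ^+ 2 * Log x1 ^+ d), (4 * dim%:R ^+ d / delta).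
have x1_1 : 1 <= x1 by rewrite le_max x0_1.
split; first by rewrite mulr_ge0 ?exprn_ge0// ?(ltW (Log_gt0 _))//; lra.
  by rewrite divr_ge0 ?mulr_ge0 ?exprn_ge0// ltW.
(* The side [J ^ 2] suffices because [Y <= z <= x ^+ 2 <= J ^ 2]. *)
move=> J; exists (J ^ 2)%N => x /andP[x_ge0 xJ].
have LL1 := LogLog_ge1 x.
have LL0 := LogLog_gt0 x.
rewrite /lil_moment subn1/=.
have [xx1|x1x] := ltP x x1.
  apply: ler_wpDr.
    by rewrite mulr_ge0 ?sumr_ge0// divr_ge0 ?mulr_ge0 ?exprn_ge0// ltW.
  rewrite ler_pdivrMr// -[leLHS]mulr1 ler_pM ?mulr_ge0 ?exprn_ge0// ?(ltW (Log_gt0 _))//.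
  rewrite ler_pM ?exprn_ge0// ?(ltW (Log_gt0 _))//.
    by rewrite lerXn2r ?nnegrE//; lra.
  rewrite lerXn2r ?nnegrE ?(ltW (Log_gt0 _))//.
  exact/le_Log/ltW.
have ex : expR 1 <= x by rewrite (le_trans _ x1x)// le_max lexx orbT.
have x_gt0 : 0 < x by rewrite (lt_le_trans _ ex)// expR_gt0.
have x_ge1 : 1 <= x by rewrite (le_trans x1_1).
have LLx : LogLog x <= delta / 2 * x.
  by apply: hx0; rewrite (le_trans _ x1x)// le_max lexx.
(* If [\prod_i (m_i + 1) <= Y], with [Y] the integer part of [z], then
   [|shift_idx N m| <= Q * z <= x^2], so [LogLog |.|] is at most [2 * LogLog x]
   and [delta] was chosen small enough for the threshold to stay below [x]. *)
pose z := delta * x ^+ 2 / LogLog x.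
have zx : 2 * x <= z.
  rewrite /z ler_pdivlMr// expr2.
  by have := ler_wpM2l x_ge0 LLx; lra.
have z0 : 0 <= z by lra.
pose Y := Num.truncn z.
have /andP[Yz zY] := truncn_itv z0; rewrite -/Y in Yz zY.
rewrite -natr1 in zY.
have xY : x <= Y%:R by lra.
have Y0 : (0 < Y)%N by rewrite -(ltr0n R); lra.
have delta1 : Q * delta <= 1.
  rewrite -Qdelta -[leLHS]mulr1 ler_wpM2l// ?mulr_ge0 ?(ltW Q0) ?(ltW delta0)//.
  by lra.
have zx2 : Q * z <= x ^+ 2.
  rewrite /z mulrA ler_pdivrMr//.
  have x2 : 0 <= x ^+ 2 by rewrite exprn_ge0.
  have := ler_wpM2r x2 delta1; have := ler_wpM2l x2 LL1.
  by lra.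
have YJ : (Y <= J ^ 2)%N.
  rewrite -(ler_nat R) (le_trans Yz)// natrX.
  apply: (@le_trans _ _ (x ^+ 2)); last by rewrite lerXn2r ?nnegrE.
  by apply: le_trans zx2; rewrite ler_peMl.
set cnt := \sum_m _.
have cntY : Y%:R / 2 * (ln (Y%:R) / dim%:R) ^+ d <= cnt.
  apply: le_trans (count_prod_le_ln _ _ Y0 YJ) _.
  apply: ler_sum => m _; rewrite ler_nat.
  have [pY|//] := boolP (_ <= Y)%N.
  suff -> : K * lil_norm R (shift_idx N m) < x by [].
  apply: lil_norm_lt => //.
  have card_le : (idx_card (shift_idx N m))%:R <= Q * z.
    apply: (@le_trans _ _ (Q * Y%:R)); last by rewrite ler_wpM2l// ltW.
    rewrite -natrM ler_nat (leq_trans _ (leq_mul (leqnn _) pY))//.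
    rewrite -[X in (N.+1 ^ X)%N](card_ord dim) -prod_nat_const -big_split/=.
    by apply: leq_prod => i _; rewrite ffunE mulSn -addSn leq_add2l leq_pmulr.
  have LLn : LogLog ((idx_card (shift_idx N m))%:R) <= 2 * LogLog x.
    exact: le_trans (le_LogLog (le_trans card_le zx2)) (LogLog_sqr_le x_ge0).
  rewrite -/K'.
  apply: (@le_lt_trans _ _ (K' * (Q * z * (2 * LogLog x)))).
    by apply: ler_wpM2l => //; apply: ler_pM => //; exact/ltW/LogLog_gt0.
  have -> : K' * (Q * z * (2 * LogLog x)) = 2 * K' * (Q * delta) * x ^+ 2.
    by rewrite /z; field; rewrite gt_eqF.
  rewrite -[ltRHS]mul1r ltr_pM2r ?exprn_gt0// -Qdelta.
  by have := mulr_gt0 Q0 delta0; nra.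
have lnx0 : 0 <= ln x by rewrite ln_ge0.
(* From [z >= 2] and [Y > z - 1] follows [Y >= z / 2]; the logarithm of [Y] is bounded below through
   [x <= Y]. *)
have {}cntY : delta * x ^+ 2 / LogLog x / 4 * (ln x / dim%:R) ^+ d <= cnt.
  apply: le_trans cntY; rewrite -/z; apply: ler_pM.
  - by rewrite divr_ge0.
  - by rewrite exprn_ge0// divr_ge0.
  - by lra.
  rewrite lerXn2r ?nnegrE ?divr_ge0//; first by rewrite ln_ge0// (le_trans x_ge1).
  rewrite ler_pM2r ?invr_gt0 ?ltr0n// ler_ln ?posrE//.
  by rewrite (lt_le_trans _ xY).
have c1_0 : 0 <= 4 * dim%:R ^+ d / delta by rewrite divr_ge0 ?mulr_ge0 ?exprn_ge0// ltW.
apply: ler_wpDl.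
  by rewrite mulr_ge0 ?exprn_ge0 ?(ltW (Log_gt0 _))//; lra.
apply: le_trans (ler_wpM2l c1_0 cntY).
rewrite LogE// expr_div_n le_eqVlt; apply/orP; left; apply/eqP.
field; rewrite ?expf_neq0 ?pnatr_eq0// ?gt_eqF//.
Qed.
(** * Partial sums over boxes *)

Section PartialSum.
Variables (dim : nat).
Implicit Types n m j : idx dim.

(** The range of summation of [partial_sum] as a list of genuine indices, the form in which the
    bounds for sums of variables are stated. *)
Definition box_seq n : seq (idx dim) :=
  [seq [ffun i => nat_of_ord (k i)] |
    k : {ffun 'I_dim -> 'I_(idx_max n).+1} <-
      enum [pred k : {ffun 'I_dim -> 'I_(idx_max n).+1} |
                [forall i, (0 < k i)%N && (k i <= n i)%N]]].

Lemma le_idx_max n i : (n i <= idx_max n)%N.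
Proof. exact: leq_bigmax. Qed.

Lemma mem_box_seq n j :
  (j \in box_seq n) = [forall i, (0 < j i)%N && (j i <= n i)%N].
Proof.
apply/mapP/forallP => [[k]|jn].
  by rewrite mem_enum inE => /forallP kn -> i; rewrite ffunE.
exists [ffun i => inord (j i)].
  rewrite mem_enum inE; apply/forallP => i; have /andP[j0 ji] := jn i.
  by rewrite ffunE inordK ?j0// ltnS (leq_trans ji)// le_idx_max.
apply/ffunP => i; have /andP[j0 ji] := jn i.
by rewrite !ffunE inordK// ltnS (leq_trans ji)// le_idx_max.
Qed.

Lemma box_seq_pos n j : j \in box_seq n -> pos_idx j.
Proof. by rewrite mem_box_seq => /forallP jn i; case/andP: (jn i). Qed.

Lemma box_seq_uniq n : uniq (box_seq n).
Proof.
rewrite map_inj_uniq ?enum_uniq// => k l /ffunP kl.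
by apply/ffunP => i; apply/val_inj; have := kl i; rewrite !ffunE.
Qed.

(** The indicator of the box is a product over coordinates, so the count factorises. *)
Lemma size_box_seq n : size (box_seq n) = idx_card n.
Proof.
rewrite size_map -cardE -sum1_card big_mkcond/=.
pose b i (a : 'I_(idx_max n).+1) : nat := ((0 < a) && (a <= n i))%N.
transitivity (\sum_(k : {ffun 'I_dim -> 'I_(idx_max n).+1})
    \prod_i b i (k i))%N.
  apply: eq_bigr => k _; rewrite inE; case: ifPn => [/forallP kn|].
    by rewrite big1// => i _; rewrite /b kn.
  rewrite negb_forall => /existsP[i ki].
  by rewrite (bigD1 i)//= /b (negbTE ki).
rewrite -bigA_distr_bigA/=; apply: eq_bigr => i _.
rewrite big_ord_recl/= {1}/b/= add0n.
have -> : n i = (\sum_(a < n i) 1)%N by rewrite sum1_card card_ord.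
rewrite (big_ord_widen (idx_max n) (fun=> 1%N)); last exact: le_idx_max.
rewrite [RHS]big_mkcond/=; apply: eq_bigr => a _.
by rewrite /b lift0/=; case: ltnP.
Qed.

Variables (R : realType) (T : Type) (X : idx dim -> T -> R).

Lemma partial_sumE n w : partial_sum X n w = \sum_(j <- box_seq n) X j w.
Proof. by rewrite big_map big_enum. Qed.

(** Writing all smaller partial sums over one common box allows the alternating sum over corners to
    be exchanged with the sum over indices. *)
Lemma partial_sum_sub n m w : (forall i, m i <= n i)%N ->
  partial_sum X m w =
  \sum_(j <- box_seq n) \prod_i (j i <= m i)%N%:R * X j w.
Proof.
move=> mn; rewrite partial_sumE.
transitivity (\sum_(j <-
    [seq j : idx dim <- box_seq n | [forall i, (j i <= m i)%N]]) X j w).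
  apply: perm_big; apply: uniq_perm; rewrite ?filter_uniq ?box_seq_uniq// => j.
  rewrite mem_filter !mem_box_seq; apply/forallP/andP => [jm|[/forallP h /forallP k] i].
    split; apply/forallP => i; first by case/andP: (jm i).
    by case/andP: (jm i) => -> /leq_trans; apply.
  by rewrite h andbT; case/andP: (k i).
rewrite big_filter big_mkcond/=; apply: eq_bigr => j _.
case: ifPn => [/forallP jm|].
  by rewrite big1 ?mul1r// => i _; rewrite jm.
rewrite negb_forall => /existsP[i ji].
by rewrite (bigD1 i)//= (negbTE ji) !mul0r.
Qed.

Definition corner n (J : {set 'I_dim}) : idx dim := [ffun i => (n i - (i \in J))%N].

(** After exchanging the sums, the coefficient of [X j] is the product over [i] of [1[j_i <= n_i] -
    1[j_i <= n_i - 1]], which vanishes on the box unless [j = n]. Positivity of [n] makes the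
    truncated subtraction in [corner] harmless. *)
Lemma mixed_difference n w : pos_idx n ->
  X n w = \sum_(J : {set 'I_dim}) (-1) ^+ #|J| * partial_sum X (corner n J) w.
Proof.
move=> n0.
under eq_bigr => J _.
  rewrite (@partial_sum_sub n); last by move=> i; rewrite ffunE leq_subr.
  rewrite mulr_sumr.
  over.
rewrite exchange_big/=.
have nin : n \in box_seq n.
  by rewrite mem_box_seq; apply/forallP => i; rewrite n0 leqnn.
rewrite (bigD1_seq n)//= ?box_seq_uniq//.
have E j : \sum_(J : {set 'I_dim})
    (-1) ^+ #|J| * (\prod_i (j i <= corner n J i)%N%:R * X j w) =
    \prod_i (- (j i <= (n i).-1)%N%:R + (j i <= n i)%N%:R) * X j w.
  rewrite bigA_distr mulr_suml; apply: eq_bigr => J _.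
  rewrite mulrA -prodr_const big_mkcond -big_split/=; congr (_ * _).
  apply: eq_bigr => i _; rewrite ffunE.
  by case: (i \in J); rewrite ?mulN1r ?subn1 ?mul1r ?subn0.
rewrite E big1 ?mul1r; last first.
  by move=> i _; rewrite leqnn -ltnS prednK ?n0// ltnn oppr0 add0r.
rewrite big1_seq ?addr0// => j /andP[jn _]; rewrite E.
have [i ji] : exists i, j i != n i.
  apply/existsP; apply: contraNT jn; rewrite negb_exists => /forallP jn.
  by apply/eqP/ffunP => i; apply/eqP; have := jn i; rewrite negbK.
have predE : (j i <= (n i).-1)%N = (j i < n i)%N.
  by rewrite -[in RHS](prednK (n0 i)).
by rewrite (bigD1 i)//= predE (leq_eqVlt (j i)) (negbTE ji)/= addNr !mul0r.
Qed.

Lemma norm_mixed_difference_le n w (B : R) : pos_idx n ->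
  (forall J, `|partial_sum X (corner n J) w| <= B) -> `|X n w| <= 2 ^+ dim * B.
Proof.
move=> n0 SB; rewrite mixed_difference// (le_trans (ler_norm_sum _ _ _))//.
apply: (@le_trans _ _ (\sum_(J : {set 'I_dim}) B)).
  by apply: ler_sum => J _; rewrite normrM normrX normrN1 expr1n mul1r.
have c : #|{set 'I_dim}| = (2 ^ dim)%N.
  by rewrite -cardsT -powersetT card_powerset cardsT card_ord.
by rewrite sumr_const c -[B *+ _]mulr_natl natrX.
Qed.

End PartialSum.

(** * Finite upper limits and monotonicity of the normalisation *)

(** One integer serves both as threshold for the coordinates and as bound for the values, so
    finiteness becomes a countable union of conditions. *)
Lemma limsup_along_infty_lty (R : realType) dim (f : idx dim -> R) :
  (limsup_along (fun n => (f n)%:E) (@idx_to_infty dim) < +oo)%E <->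
  exists N : nat, forall n : idx dim, (forall i, (N < n i)%N) -> f n <= N%:R.
Proof.
split=> [|[N fN]].
  move=> /ereal_inf_lt[_ [V [N0 N0V] <-]].
  set s := ereal_sup _ => sy.
  have [N1 sN1] : exists N1 : nat, (s <= N1%:R%:E)%E.
    move: sy; case: s => [r| |] // _; last by exists 0%N; rewrite leNye.
    exists (Num.truncn `|r|).+1; rewrite lee_fin (le_trans (ler_norm _))//.
    exact/ltW/truncnS_gt.
  exists (maxn N0 N1) => n Nn.
  have Vn : V n.
    by apply: N0V => i; rewrite (leq_trans (leq_maxl N0 N1))// ltnW.
  rewrite -lee_fin; apply: (@le_trans _ _ s).
    by apply: ereal_sup_ubound; exists n.
  by rewrite (le_trans sN1)// lee_fin ler_nat leq_maxr.
apply: (@le_lt_trans _ _ N%:R%:E); last by rewrite ltry.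
apply: (@le_trans _ _ (ereal_sup ((fun n => (f n)%:E) @`
    [set n : idx dim | forall i, (N < n i)%N]))).
  apply: ereal_inf_lbound; exists [set n : idx dim | forall i, (N < n i)%N] => //.
  by exists N.+1 => n h i; exact: h.
by apply: ge_ereal_sup => _ [n Nn <-]; rewrite lee_fin fN.
Qed.

Lemma idx_card_gt0 dim (n : idx dim) : pos_idx n -> (0 < idx_card n)%N.
Proof. by move=> n0; rewrite prodn_gt0// => i; exact: n0. Qed.

Lemma lil_norm_gt0 (R : realType) dim (n : idx dim) : (1 <= dim)%N -> pos_idx n ->
  0 < lil_norm R n.
Proof.
move=> d0 n0.
by rewrite sqrtr_gt0 !mulr_gt0 ?ltr0n ?LogLog_gt0// idx_card_gt0.
Qed.

Lemma le_lil_norm (R : realType) dim (m n : idx dim) : (forall i, m i <= n i)%N ->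
  lil_norm R m <= lil_norm R n.
Proof.
move=> mn; rewrite ler_wsqrtr//.
have c : (idx_card m)%:R <= (idx_card n)%:R :> R by rewrite ler_nat leq_prod.
rewrite ler_pM ?mulr_ge0 ?(ltW (LogLog_gt0 _)) ?le_LogLog//.
by rewrite ler_wpM2l// mulr_ge0.
Qed.
(** * Second-moment bounds under nonpositive correlation *)

Section Probability.
Context d0 (T : measurableType d0) (R : realType) (P : probability T R).

Lemma bounded_Lfun2 (f : T -> R) (B : R) : measurable_fun setT f ->
  (forall x, `|f x| <= B) -> f \in Lfun P 2%:E.
Proof.
move=> mf fB; rewrite inE; apply/andP; split; rewrite inE//=.
rewrite /finite_norm unlock poweR_lty//.
apply: (@le_lt_trans _ _ (\int[P]_x (cst (B `^ 2)%:E x))%E).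
  apply: ge0_le_integral => //.
  - by move=> x _; rewrite lee_fin powR_ge0.
  - apply/measurable_EFinP.
    apply: (@measurableT_comp _ _ _ _ _ _ (@powR R ^~ 2)) => //.
    exact: measurableT_comp.
  - move=> x _; rewrite lee_fin ge0_ler_powR// nnegrE//.
    exact: le_trans (fB x).
by rewrite integral_cst//= probability_setT mule1 ltry.
Qed.

Lemma Lfun21 (f : T -> R) : f \in Lfun P 2%:E -> f \in Lfun P 1.
Proof. by apply: Lfun_subset12; exact: fin_num_measure. Qed.

Lemma Lfun2_sum (I : Type) (s : seq I) (Z : I -> T -> R) :
  (forall i, Z i \in Lfun P 2%:E) -> \sum_(i <- s) Z i \in Lfun P 2%:E.
Proof. by move=> Z2; rewrite rpred_sum ?lee1n. Qed.

Lemma covariance_sumr_le0 (I : eqType) (s : seq I) (Y : T -> R) (Z : I -> T -> R) :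
  Y \in Lfun P 2%:E -> (forall i, Z i \in Lfun P 2%:E) ->
  (forall i, i \in s -> (covariance P Y (Z i) <= 0)%E) ->
  (covariance P Y (\sum_(i <- s) Z i) <= 0)%E.
Proof.
move=> Y2 Z2; elim: s => [|i s ih] c0.
  by rewrite big_nil (covariance_cst_r _ _ 0).
rewrite big_cons (covarianceDr Y2 (Z2 i) (Lfun2_sum s Z2)).
rewrite -[leRHS]adde0 leeD ?c0 ?mem_head// ih// => j js.
by rewrite c0// inE js orbT.
Qed.

Lemma variance_sum_le (I : eqType) (s : seq I) (Z : I -> T -> R) :
  uniq s -> (forall i, Z i \in Lfun P 2%:E) ->
  (forall i j, i \in s -> j \in s -> i != j -> (covariance P (Z i) (Z j) <= 0)%E) ->
  ('V_P[(\sum_(i <- s) Z i)%R] <= \sum_(i <- s) 'V_P[Z i])%E.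
Proof.
move=> + Z2; elim: s => [_ _|i s ih /= /andP[is_ us] c0].
  by rewrite !big_nil (variance_cst _ 0).
rewrite !big_cons (varianceD (Z2 i) (Lfun2_sum s Z2)).
rewrite -[leRHS]adde0 leeD//.
  by rewrite leeD// ih// => j k js ks; apply: c0; rewrite inE ?js ?ks orbT.
rewrite mule_ge0_le0// covariance_sumr_le0// => j js.
by rewrite c0 ?mem_head ?inE ?js ?orbT//; apply: contraNneq is_ => ->.
Qed.

Lemma variance_le_sqr (Y : T -> R) : Y \in Lfun P 2%:E ->
  ('V_P[Y] <= 'E_P[(Y ^+ 2)%R])%E.
Proof.
move=> Y2; rewrite varianceE// -[leRHS]sube0 leeB//.
by rewrite -(fineK (expectation_fin_num (Lfun21 Y2))) -EFin_expe lee_fin sqr_ge0.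
Qed.

(** Nonpositive covariances bound the variance of the sum by the sum of the variances, hence of the
    second moments. The inequality is kept multiplied out, and [A] is any event on which the
    deviation is large. *)
Lemma chebyshev_sum (I : eqType) (s : seq I) (Z : I -> T -> R) (A : set T) (eps : R) :
  0 < eps -> uniq s -> (forall i, Z i \in Lfun P 2%:E) ->
  (forall i j, i \in s -> j \in s -> i != j -> (covariance P (Z i) (Z j) <= 0)%E) ->
  measurable A ->
  (forall w, A w -> eps <=
     `|\sum_(i <- s) Z i w - \sum_(i <- s) fine 'E_P[Z i]|) ->
  ((eps ^+ 2)%:E * P A <= \sum_(i <- s) 'E_P[(Z i ^+ 2)%R])%E.
Proof.
move=> e0 us Z2 c0 mA hA.
pose S := \sum_(i <- s) Z i.
have S2 : S \in Lfun P 2%:E by exact: Lfun2_sum.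
have ES : fine 'E_P[S] = \sum_(i <- s) fine 'E_P[Z i].
  have -> : S = \sum_(f <- map Z s) f by rewrite big_map.
  rewrite expectation_sum; last by move=> f /mapP[i _ ->]; exact: Lfun21.
  by rewrite big_map sum_fine// => i _; apply/expectation_fin_num/Lfun21.
have mS : S \in mfun by move: S2; rewrite inE => /andP[].
pose SX : {RV P >-> R} := mfun_Sub mS.
have AS : A `<=` [set x | (eps <= `|SX x - fine ('E_P[SX])|)%R ].
  by move=> w Aw /=; rewrite ES /S fct_sumE; exact: hA.
have := chebyshev SX e0; rewrite lee_pdivlMl ?exprn_gt0// => h.
apply: (@le_trans _ _ 'V_P[S]).
  apply: le_trans h; rewrite lee_pmul2l ?lte_fin ?exprn_gt0//.
  apply: le_measure; rewrite ?inE//.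
  rewrite [X in measurable X](_ : _ =
    [set: T] `&` (fun x => `|SX x - fine 'E_P[SX]|) @^-1` `[eps, +oo[); last first.
    by rewrite setTI; apply/seteqP; split => x /=; rewrite in_itv/= andbT.
  suff : measurable_fun setT (fun x => `|SX x - fine 'E_P[SX]|) by apply.
  by apply: measurableT_comp => //; apply: measurable_funB.
rewrite (le_trans (variance_sum_le us Z2 c0))// lee_sum// => i _.
exact: variance_le_sqr.
Qed.

(* A quantitative second Borel-Cantelli lemma: the number of events [B i] that
   occur has variance at most its mean, and it vanishes on [A]. *)
Lemma prob_mul_sum_le1 (I : eqType) (s : seq I) (B : I -> set T) (A : set T) :
  uniq s -> (forall i, measurable (B i)) -> measurable A ->
  (forall i j, i \in s -> j \in s -> i != j ->
     (covariance P (\1_(B i) : T -> R) (\1_(B j) : T -> R) <= 0)%E) ->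
  (forall w i, A w -> i \in s -> ~ B i w) ->
  (P A * \sum_(i <- s) P (B i) <= 1)%E.
Proof.
move=> us mB mA c0 AB.
have mI i : measurable_fun [set: T] (\1_(B i) : T -> R) by exact: measurable_indic.
have I2 i : (\1_(B i) : T -> R) \in Lfun P 2%:E.
  apply: (@bounded_Lfun2 _ 1) => // x.
  by rewrite indicE; case: (_ \in _); rewrite ?normr1 ?normr0.
have Pf i : P (B i) \is a fin_num by exact: fin_num_measure.
pose q := \sum_(i <- s) fine (P (B i)).
have qE : (\sum_(i <- s) P (B i) = q%:E)%E.
  by rewrite /q -sumEFin; apply: eq_bigr => i _; rewrite fineK.
have : 0 <= q by apply: sumr_ge0 => i _; exact: fine_ge0.
rewrite le_eqVlt => /predU1P[q0|q0]; first by rewrite qE -q0 mule0.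
(* With [eps = q] Chebyshev reads [q ^+ 2 * P A <= q], since an indicator is its own square; it
   remains to divide by [q]. *)
have := @chebyshev_sum _ s (fun i => \1_(B i)) A q q0 us I2 c0 mA.
have -> : (\sum_(i <- s) 'E_P[(\1_(B i) ^+ 2)%R] = q%:E)%E.
  rewrite -qE; apply: eq_bigr => i _; rewrite -(expectation_indic P (mB i)).
  congr expectation; apply/funext => x.
  by rewrite exprfctE indicE; case: (_ \in _); rewrite ?expr1n ?expr0n.
have hA w : A w -> q <= `|\sum_(i <- s) \1_(B i) w - \sum_(i <- s) fine 'E_P[\1_(B i)]|.
  move=> Aw; rewrite big1_seq; last first.
    move=> i /andP[_ si]; rewrite indicE memNset//; exact: AB.
  rewrite sub0r normrN (_ : \sum_(i <- s) _ = q) ?ler_norm//.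
  by apply: eq_bigr => i _; rewrite expectation_indic.
move=> /(_ hA); rewrite qE -(fineK (fin_num_measure P _ mA)) -!EFinM !lee_fin.
by rewrite expr2 -mulrA ger_pMr// mulrC.
Qed.

(** Monotone convergence along the truncations to [|Y| <= J]. It is needed because a finite box
    controls the moment function only on a bounded range. *)
Lemma integral_le_of_trunc (g Y : T -> R) (b : \bar R) :
  measurable_fun setT g -> measurable_fun setT Y -> (forall w, 0 <= g w) ->
  (forall J : nat, (\int[P]_w (g w * (`|Y w| <= J%:R)%R%:R)%:E <= b)%E) ->
  (\int[P]_w (g w)%:E <= b)%E.
Proof.
move=> mg mY g0 hb.
pose gJ (J : nat) w := (g w * (`|Y w| <= J%:R)%R%:R)%:E.
have mgJ J : measurable_fun setT (gJ J).
  apply/measurable_EFinP; apply: measurable_funM => //.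
  rewrite [X in measurable_fun _ X](_ : _ = \1_[set w | `|Y w| <= J%:R]); last first.
    by apply/funext => w; rewrite indicE mem_setE.
  apply: measurable_indic.
  rewrite [X in measurable X](_ : _ =
    [set: T] `&` (fun x => `|Y x|) @^-1` `]-oo, J%:R]); last first.
    by rewrite setTI; apply/seteqP; split => x /=; rewrite in_itv/=.
  suff : measurable_fun setT (fun x => `|Y x|) by apply.
  exact: measurableT_comp.
have gJ0 J w : [set: T] w -> (0 <= gJ J w)%E by rewrite lee_fin mulr_ge0.
have ndgJ w : [set: T] w -> nondecreasing_seq (gJ ^~ w).
  move=> _ m n mn; rewrite lee_fin ler_wpM2l// ler_nat.
  have [Ym|//] := boolP (`|Y w| <= m%:R).
  by rewrite (le_trans Ym)// ler_nat.
apply: (@le_trans _ _ (\int[P]_w limn (gJ ^~ w))%E).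
  apply: ge0_le_integral => //.
  - by move=> w _; rewrite lee_fin.
  - exact/measurable_EFinP.
  - apply: emeasurable_fun_cvg mgJ _ => x _.
    by apply: ereal_nondecreasing_is_cvgn; exact: ndgJ.
move=> w _; pose J := (Num.truncn `|Y w|).+1.
  have -> : (g w)%:E = gJ J w.
    by rewrite /gJ (ltW (truncnS_gt _)) mulr1.
  apply: lime_ge; first by apply: ereal_nondecreasing_is_cvgn; exact: ndgJ.
  by exists J => // n /= Jn; exact: ndgJ.
rewrite monotone_convergence//; apply: lime_le; last by exists 0%N => // n _; exact: hb.
apply: ereal_nondecreasing_is_cvgn => m n mn.
by apply: ge0_le_integral => // w _; [exact: gJ0|exact: ndgJ].
Qed.

End Probability.

(** * Monotone truncation *)

(** Values are moved to the nearest point of [[-M, M]] rather than set to zero outside it: this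
    keeps the map nondecreasing, so negative association applies to the truncated variables. *)
Definition clip (R : realType) (M x : R) : R := Num.max (- M) (Num.min x M).

Section Clip.
Variable R : realType.
Implicit Types M x y : R.

Lemma clip_homo M : {homo clip M : x y / x <= y}.
Proof.
move=> x y xy; rewrite /clip ge_max le_max lexx/= le_max.
by apply/orP; right; rewrite le_min !ge_min xy lexx orbT.
Qed.

Lemma norm_clip_le M x : 0 <= M -> `|clip M x| <= M.
Proof.
move=> M0; rewrite ler_norml /clip le_max lexx/= ge_max ge_min lexx orbT andbT.
by rewrite ge0_cp.
Qed.

Lemma norm_sub_clip_le M x : 0 <= M -> `|x - clip M x| <= `|x| * (M < `|x|)%R%:R.
Proof.
move=> M0; rewrite /clip; have [|] := lerP `|x| M.
  rewrite ler_norml mulr0 => /andP[Mx xM].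
  by rewrite min_l// max_r// subrr normr0.
rewrite mulr1; have [x0|x0] := lerP 0 x.
  rewrite (ger0_norm x0) => Mx.
  rewrite min_r ?(ltW Mx)// max_r; last by lra.
  by rewrite ger0_norm; lra.
rewrite (ltr0_norm x0) => Mx; rewrite min_l; last by lra.
by rewrite max_l ?ler0_norm; lra.
Qed.

Lemma measurable_clip M : measurable_fun [set: R] (clip M).
Proof. by apply: measurable_maxr => //; exact: measurable_minr. Qed.

End Clip.

(** * Markov's inequality, equality in law and a weak law of large numbers *)

Section WeakLaw.
Context d0 (T : measurableType d0) (R : realType) (P : probability T R).

Lemma markov_ge0 (W : T -> R) (c : R) : measurable_fun setT W ->
  (forall w, 0 <= W w) -> 0 < c ->
  (c%:E * P [set w | (c <= W w)%R] <= \int[P]_w (W w)%:E)%E.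
Proof.
move=> mW W0 c0.
have mc : measurable [set w | (c <= W w)%R].
  rewrite [X in measurable X](_ : _ = [set: T] `&` W @^-1` `[c, +oo[).
    exact: mW.
  by rewrite setTI; apply/seteqP; split => x /=; rewrite in_itv/= andbT.
rewrite -(setIT [set w | _]) -integral_indic// -ge0_integralZl_EFin//.
- apply: ge0_le_integral => //.
  + by move=> w _; rewrite mule_ge0// lee_fin// ltW.
  + by apply: measurable_funeM; apply/measurable_EFinP/measurable_indic.
  + exact/measurable_EFinP.
  + move=> w _; rewrite -EFinM lee_fin indicE.
    have [|_] := boolP (w \in _); last by rewrite mulr0.
    by rewrite inE mulr1.
- by apply/measurable_EFinP/measurable_indic.
- exact: ltW.
Qed.

Definition same_distribution (Y Z : {RV P >-> R}) :=
  forall B : set R, measurable B -> distribution P Y B = distribution P Z B.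

Lemma same_distribution_ge0_integral (Y Z : {RV P >-> R}) (f : R -> R) :
  same_distribution Y Z -> measurable_fun setT f -> (forall x, 0 <= f x) ->
  (\int[P]_w (f (Y w))%:E = \int[P]_w (f (Z w))%:E)%E.
Proof.
move=> YZ mf f0.
have mf' : measurable_fun setT (EFin \o f) by exact/measurable_EFinP.
have f0' y : (0 <= (EFin \o f) y)%E by rewrite lee_fin.
transitivity (\int[distribution P Y]_y (EFin \o f) y)%E.
  by rewrite ge0_integral_distribution.
rewrite (eq_measure_integral (distribution P Z)); last by move=> B mB _; exact: YZ.
by rewrite ge0_integral_distribution.
Qed.

Lemma same_distribution_expectation (Y Z : {RV P >-> R}) (f : R -> R) :
  same_distribution Y Z -> measurable_fun setT f ->
  f \o Y \in Lfun P 1 -> f \o Z \in Lfun P 1 ->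
  ('E_P[f \o Y] = 'E_P[f \o Z])%E.
Proof.
move=> YZ mf /Lfun1_integrable fY /Lfun1_integrable fZ.
have mf' : measurable_fun setT (EFin \o f) by exact/measurable_EFinP.
rewrite unlock.
transitivity (\int[distribution P Y]_y (EFin \o f) y)%E.
  by rewrite integral_distribution.
rewrite (eq_measure_integral (distribution P Z)); last by move=> B mB _; exact: YZ.
by rewrite integral_distribution.
Qed.

(** Let [C] be the event that the total clipping error [W] reaches a quarter of [m * |mu|]. Since
    [W] has mean [m * r], Markov bounds [P C] by [4 * r / |mu|]. On [A] outside [C] the clipped sum
    is far from its mean, and Chebyshev with second moments at most [M ^+ 2] gives the other
    term. *)
Lemma weak_law_bound (I : eqType) (s : seq I) (Y : I -> {RV P >-> R})
    (Y0 : {RV P >-> R}) (A : set T) (M : R) :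
  let mu := fine 'E_P[Y0] in
  let r := fine (\int[P]_w (`|Y0 w - clip M (Y0 w)|)%:E)%E in
  uniq s -> (0 < size s)%N -> (forall i, i \in s -> same_distribution (Y i) Y0) ->
  0 <= M -> (Y0 : T -> R) \in Lfun P 1 ->
  (forall i j, i \in s -> j \in s -> i != j ->
     (covariance P (clip M \o Y i) (clip M \o Y j) <= 0)%E) ->
  measurable A ->
  (forall w, A w -> `|\sum_(i <- s) Y i w| < (size s)%:R * `|mu| / 4) ->
  mu != 0 -> r <= `|mu| / 4 ->
  fine (P A) <= 16 * M ^+ 2 / ((size s)%:R * mu ^+ 2) + 4 * r / `|mu|.
Proof.
move=> mu r us s0 sd M0 Y01 c0 mA hA mu0 rmu.
have Z2 (V : {RV P >-> R}) : clip M \o V \in Lfun P 2%:E.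
  apply: (@bounded_Lfun2 _ _ _ _ _ M) => [|x /=]; last exact: norm_clip_le.
  by apply: measurableT_comp => //; exact: measurable_clip.
have Z1 (V : {RV P >-> R}) : clip M \o V \in Lfun P 1 by exact: Lfun21.
have D1 : (Y0 \- (clip M \o Y0)) \in Lfun P 1 by rewrite rpredB.
pose dist (x : R) := `|x - clip M x|.
have mdist : measurable_fun setT dist.
  apply: measurableT_comp => //; apply: measurable_funB => //.
  exact: measurable_clip.
pose nu := fine 'E_P[clip M \o Y0].
have iD : (\int[P]_w (dist (Y0 w))%:E = r%:E)%E.
  rewrite fineK//; have /Lfun1_integrable/integrable_abse := D1.
  exact: integrable_fin_num.
have munu : `|mu - nu| <= r.
  rewrite -lee_fin -iD /mu /nu -fineB ?expectation_fin_num//.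
  rewrite -expectationB// -abse_EFin fineK ?expectation_fin_num//.
  rewrite unlock; apply: le_abse_integral => //.
  by have /Lfun1_integrable/integrableP[] := D1.
pose m : R := (size s)%:R.
have m0 : 0 < m by rewrite ltr0n.
have nmu0 : 0 < `|mu| by rewrite normr_gt0.
pose W w := \sum_(i <- s) dist (Y i w).
have mdY i : measurable_fun setT (fun w => dist (Y i w)).
  exact: measurableT_comp.
have mW : measurable_fun setT W by apply: measurable_sum.
have W0 w : 0 <= W w by apply: sumr_ge0 => i _; exact: normr_ge0.
pose c := m * `|mu| / 4.
have c_0 : 0 < c by rewrite divr_gt0// mulr_gt0.
pose C := [set w | c <= W w].
have mC : measurable C.
  rewrite [C](_ : _ = [set: T] `&` W @^-1` `[c, +oo[).
    exact: mW.
  by rewrite setTI; apply/seteqP; split => x /=; rewrite in_itv/= andbT.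
have PC : fine (P C) <= 4 * r / `|mu|.
  have := markov_ge0 mW W0 c_0; rewrite -/C.
  have -> : (\int[P]_w (W w)%:E = (m * r)%:E)%E.
    under eq_integral do rewrite /W -sumEFin.
    rewrite ge0_integral_sum//; last 2 first.
      by move=> i; apply/measurable_EFinP.
      by move=> i w _; rewrite lee_fin normr_ge0.
    rewrite (eq_big_seq (fun=> r%:E)); last first.
      move=> i si; rewrite -iD.
      by apply: (same_distribution_ge0_integral (sd i si)) => // x; exact: normr_ge0.
    by rewrite sumEFin big_const_seq count_predT iter_addr_0 -mulr_natl.
  rewrite -(fineK (fin_num_measure P _ mC)) -EFinM lee_fin mulrC -ler_pdivlMr//.
  move/le_trans; apply; rewrite le_eqVlt; apply/orP; left; apply/eqP.
  by rewrite /c; field; rewrite ?gt_eqF.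
have PAC : fine (P (A `\` C)) <= 16 * M ^+ 2 / (m * mu ^+ 2).
  have mAC : measurable (A `\` C) by exact: measurableD.
  have := @chebyshev_sum _ _ _ P I s (fun i => clip M \o Y i) (A `\` C) c c_0 us
    (fun i => Z2 (Y i)) c0 mAC.
  have hAC w : (A `\` C) w -> c <=
      `|\sum_(i <- s) (clip M \o Y i) w - \sum_(i <- s) fine 'E_P[clip M \o Y i]|.
    move=> [Aw /negP]; rewrite -ltNge => Ww.
    have -> : \sum_(i <- s) fine 'E_P[clip M \o Y i] = m * nu.
      rewrite (eq_big_seq (fun=> nu)); last first.
        move=> i si; rewrite (same_distribution_expectation (sd i si))//.
        exact: measurable_clip.
      by rewrite big_const_seq count_predT iter_addr_0 -mulr_natl.
    have Sw := hA w Aw.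
    set S := \sum_(i <- s) Y i w in Sw.
    set U := \sum_(i <- s) (clip M \o Y i) w.
    have SU : `|S - U| <= W w.
      by rewrite /S /U -sumrB; exact: ler_norm_sum.
    (* The sum, the clipping error and the shift of the mean each use at most a quarter of
       [m * |mu|], which leaves a quarter for the deviation of the clipped sum. *)
    have mmu : m * `|mu| <= `|S| + `|S - U| + `|U - m * nu| + m * `|mu - nu|.
      rewrite -[X in X * `|mu|](gtr0_norm m0) -[X in _ + X * _](gtr0_norm m0) -!normrM.
      have -> : m * mu = S - (S - U) - (U - m * nu) + m * (mu - nu) by ring.
      apply: le_trans (ler_normD _ _) _; rewrite lerD2r.
      apply: le_trans (ler_normB _ _) _; rewrite lerD2r.
      exact: ler_normB.
    have mr : m * `|mu - nu| <= m * (`|mu| / 4).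
      by rewrite ler_pM2l//; exact: le_trans rmu.
    by rewrite /c in Ww Sw *; rewrite -/m in Sw; lra.
  move=> /(_ hAC) h.
  have {}h : ((c ^+ 2)%:E * P (A `\` C) <= (m * M ^+ 2)%:E)%E.
    apply: le_trans h _.
    have -> : (m * M ^+ 2)%:E = (\sum_(i <- s) (M ^+ 2)%:E)%E.
      by rewrite sumEFin big_const_seq count_predT iter_addr_0 -mulr_natl.
    apply: lee_sum => i _; rewrite -(expectation_cst P (M ^+ 2)).
    apply: expectation_le => //.
    - rewrite exprfctE; apply: measurable_funX.
      by apply: measurableT_comp => //; exact: measurable_clip.
    - by move=> x; rewrite exprfctE sqr_ge0.
    - by move=> x; rewrite sqr_ge0.
    - apply/aeW => x; rewrite exprfctE/= -(real_normK (num_real _)).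
      by rewrite lerXn2r ?nnegrE// norm_clip_le.
  move: h; rewrite -(fineK (fin_num_measure P _ mAC)) -EFinM lee_fin mulrC.
  rewrite -ler_pdivlMr ?exprn_gt0// => /le_trans; apply.
  rewrite le_eqVlt; apply/orP; left; apply/eqP; rewrite /c.
  by rewrite -[in RHS](real_normK (num_real mu)); field; rewrite ?gt_eqF.
apply: le_trans (lerD PAC PC).
rewrite -fineD ?fin_num_measure//; last exact: measurableD.
rewrite fine_le ?fin_numD ?fin_num_measure//; try exact: measurableD.
apply: (@le_trans _ _ (P (A `\` C `|` C))).
  apply: le_measure; rewrite ?inE//.
    by apply: measurableU => //; exact: measurableD.
  by move=> w Aw; have [Cw|Cw] := pselect (C w); [right|left].
by rewrite measureU2//; exact: measurableD.
Qed.

End WeakLaw.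

(** * Growth and measurability of the moment function *)

(** Holds since [LogLog x <= a * x] eventually and [Log x >= 1]. With [a = 1] it yields
    integrability, with small [a] a small clipping error. *)
Lemma le_lil_moment (R : realType) dim (a : R) : 0 < a ->
  exists2 x0 : R, 0 < x0 & forall x, x0 <= x -> x <= a * lil_moment dim x.
Proof.
move=> a0; have [x0 x0_1 hx0] := LogLog_le_linear a0.
exists x0 => [|x xx0]; first by lra.
have x_0 : 0 <= x by lra.
rewrite /lil_moment mulrA ler_pdivlMr ?LogLog_gt0//.
apply: (@le_trans _ _ (x * (a * x))); first by rewrite ler_wpM2l// hx0.
rewrite [leRHS](_ : _ = a * x ^+ 2 * Log x ^+ (dim - 1)); last by ring.
rewrite (_ : x * (a * x) = a * x ^+ 2); last by ring.
rewrite ler_peMr ?mulr_ge0 ?exprn_ge0 ?(ltW a0)//.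
by rewrite exprn_ege1// Log_ge1.
Qed.

Lemma measurable_lil_moment (R : realType) dim :
  measurable_fun [set: R] (@lil_moment R dim).
Proof.
rewrite /lil_moment; apply: measurable_funM.
  apply: measurable_funM; first exact: measurable_funX.
  by apply: measurable_funX; exact: measurable_Log.
apply: nonincreasing_measurable => // x y xy.
by rewrite lef_pV2 ?posrE ?LogLog_gt0// le_LogLog.
Qed.

(** * Negatively associated fields *)

Section Field.
Context d0 (T : measurableType d0) (R : realType) (P : probability T R).
Variables (dim : nat) (X : idx dim -> {RV P >-> R}).
Hypothesis dim_gt0 : (1 <= dim)%N.
Hypothesis na : negatively_associated X.
Hypothesis idd : identically_distributed X.

Let S n w := partial_sum (fun k w => X k w) n w.
Let X1 := X (one_idx dim).

Lemma one_idx_pos : pos_idx (one_idx dim).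
Proof. by move=> i; rewrite ffunE. Qed.

Lemma same_distribution_one n : pos_idx n -> same_distribution (X n) X1.
Proof. by move=> n0 B mB; apply: idd => //; exact: one_idx_pos. Qed.

(** Negative association for two singletons, encoded as families over ['I_1]; square integrability
    makes the covariance exist. *)
Lemma na_covariance_le0 n m (f g : R -> R) : pos_idx n -> pos_idx m -> n != m ->
  {homo f : x y / x <= y} -> {homo g : x y / x <= y} ->
  f \o X n \in Lfun P 2%:E -> g \o X m \in Lfun P 2%:E ->
  (covariance P (f \o X n) (g \o X m) <= 0)%E.
Proof.
move=> n0 m0 nm fh gh f2 g2.
have inj1 (j : idx dim) : injective (fun _ : 'I_1 => j) by move=> i k _; rewrite !ord1.
apply: (na (inj1 n) (inj1 m) _ _ _
  (f := fun u => f (u ord0)) (g := fun u => g (u ord0))) => //.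
- by move=> _ _ /eqP; apply/negP.
- by move=> u v uv; exact: fh.
- by move=> u v uv; exact: gh.
- exact: Lfun21.
- exact: Lfun21.
- exact: Lfun2_mul_Lfun1.
Qed.

Lemma measurable_X_gt n (t : R) : measurable [set w | t < X n w].
Proof.
rewrite [X in measurable X](_ : _ = [set: T] `&` X n @^-1` `]t, +oo[); last first.
  by rewrite setTI; apply/seteqP; split => x /=; rewrite in_itv/= andbT.
by apply: (measurable_funPT (X n)).
Qed.

Lemma measurable_X_lt n (t : R) : measurable [set w | X n w < t].
Proof.
rewrite [X in measurable X](_ : _ = [set: T] `&` X n @^-1` `]-oo, t[); last first.
  by rewrite setTI; apply/seteqP; split => x /=; rewrite in_itv/=.
by apply: (measurable_funPT (X n)).
Qed.

Lemma norm_gtE n (t : R) : 0 <= t ->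
  [set w | t < `|X n w|] = [set w | t < X n w] `|` [set w | X n w < - t].
Proof.
move=> t0; apply/seteqP; split => w /=.
  by rewrite lter_normr => /orP[?|?]; [left|right; rewrite ltrNr].
by move=> [h|h]; rewrite lter_normr ?h// ltrNr h orbT.
Qed.

(** The event [|x| > t] is not monotone in [x], so the two tails are treated separately and each
    contributes 1. *)
Lemma prob_mul_sum_tail_le2 (s : seq (idx dim)) (t : idx dim -> R) (A : set T) :
  uniq s -> (forall n, n \in s -> pos_idx n) -> (forall n, 0 <= t n) ->
  measurable A -> (forall w n, A w -> n \in s -> `|X n w| <= t n) ->
  (P A * \sum_(n <- s) P [set w | (t n < `|X n w|)%R] <= 2%:E)%E.
Proof.
move=> us sp t0 mA AX.
pose up (n : idx dim) (x : R) : R := (t n < x)%R%:R.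
(* The minus sign makes the lower-tail indicator nondecreasing; changing both signs leaves a
   covariance unchanged. *)
pose lo (n : idx dim) (x : R) : R := - (x < - t n)%R%:R.
have uph n : {homo up n : x y / x <= y}.
  move=> x y xy; rewrite /up ler_nat.
  by case: (ltP (t n) x) => // tx; rewrite (lt_le_trans tx xy).
have loh n : {homo lo n : x y / x <= y}.
  move=> x y xy; rewrite /lo lerN2 ler_nat.
  by case: (ltP y) => // yt; rewrite (le_lt_trans xy yt).
have upE n : (\1_[set w | t n < X n w] : T -> R) = up n \o X n.
  by apply/funext => w; rewrite indicE mem_setE.
have loE n : (\1_[set w | X n w < - t n] : T -> R) = \- (lo n \o X n).
  by apply/funext => w; rewrite indicE mem_setE/= /lo opprK.
have ind2 (B : set T) : measurable B -> (\1_B : T -> R) \in Lfun P 2%:E.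
  move=> mB; apply: (@bounded_Lfun2 _ _ _ _ _ 1) => [|w].
    exact: measurable_indic.
  by rewrite indicE; case: (_ \in _); rewrite ?normr1 ?normr0.
have up2 n : up n \o X n \in Lfun P 2%:E by rewrite -upE ind2//; exact: measurable_X_gt.
have lo2 n : lo n \o X n \in Lfun P 2%:E.
  rewrite (_ : lo n \o X n = \- (\1_[set w | X n w < - t n])); last first.
    by rewrite loE; apply/funext => w; rewrite /= opprK.
  by rewrite rpredN ?lee1n// ind2//; exact: measurable_X_lt.
have hup : (P A * \sum_(n <- s) P [set w | (t n < X n w)%R] <= 1)%E.
  apply: prob_mul_sum_le1 => // [n|n m sn sm nm|w n Aw sn /=].
  - exact: measurable_X_gt.
  - by rewrite !upE; apply: na_covariance_le0 => //; exact: sp.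
  - by apply/negP; rewrite -leNgt (le_trans (ler_norm _))// AX.
have hlo : (P A * \sum_(n <- s) P [set w | (X n w < - t n)%R] <= 1)%E.
  apply: prob_mul_sum_le1 => // [n|n m sn sm nm|w n Aw sn /=].
  - exact: measurable_X_lt.
  - rewrite !loE covarianceNN ?(Lfun21 (lo2 _)) ?Lfun2_mul_Lfun1//.
    by apply: na_covariance_le0 => //; exact: sp.
  - apply/negP; rewrite -leNgt lerNl (le_trans _ (AX w n Aw sn))//.
    by rewrite -normrN ler_norm.
apply: (@le_trans _ _ (P A * (\sum_(n <- s) P [set w | (t n < X n w)%R] +
    \sum_(n <- s) P [set w | (X n w < - t n)%R]))%E).
  rewrite lee_wpmul2l// -big_split/=; apply: lee_sum => n _.
  rewrite norm_gtE// measureU2//; [exact: measurable_X_gt|exact: measurable_X_lt].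
rewrite ge0_muleDr ?sume_ge0//.
by rewrite (_ : 2%:E = 1 + 1)%E ?leeD// -EFinD.
Qed.

Lemma measurable_S n : measurable_fun setT (S n).
Proof.
rewrite (_ : S n = fun w => \sum_(j <- box_seq n) X j w).
  exact: measurable_sum.
by apply/funext => w; exact: partial_sumE.
Qed.

(** The double role of [N] follows [limsup_along_infty_lty], so the event of the theorem is the
    union of these over [N]. *)
Definition lil_event N : set T :=
  [set w | forall n : idx dim, (forall i, (N < n i)%N) ->
    `|S n w| <= N%:R * lil_norm R n].

Lemma measurable_lil_event N : measurable (lil_event N).
Proof.
pose B (n : idx dim) := [set w | (forall i, (N < n i)%N) /\
  N%:R * lil_norm R n < `|S n w|].
rewrite (_ : lil_event N = ~` \bigcup_n B n).
  apply/measurableC/countable_bigcupT_measurable; first exact: countableP.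
  move=> n; have [Nn|Nn] := pselect (forall i, (N < n i)%N); last first.
    rewrite (_ : B n = set0); first exact: measurable0.
    by apply/seteqP; split => // w [].
  rewrite [X in measurable X](_ : _ =
      [set: T] `&` (fun w => `|S n w|) @^-1` `]N%:R * lil_norm R n, +oo[).
    have : measurable_fun setT (fun w => `|S n w|).
      by apply: measurableT_comp => //; exact: measurable_S.
    by apply.
  rewrite setTI; apply/seteqP; split => x /=; rewrite in_itv/= andbT; first by case.
  by move=> h; split.
apply/seteqP; split => w.
  by move=> wN [n _ [Nn]]; apply/negP; rewrite -leNgt; exact: wN.
move=> wB n Nn; rewrite leNgt; apply/negP => h.
by apply: wB; exists n.
Qed.

(** Otherwise the event in the hypothesis would be a countable union of null sets. *)
Lemma lil_event_gt0 :
  (0 < P [set w | limsup_along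
          (fun n : idx dim =>
             ((`|partial_sum (fun k w => X k w) n w|
               / Num.sqrt (2 * dim%:R * (idx_card n)%:R
                           * LogLog ((idx_card n)%:R)))%:E))
          (@idx_to_infty dim) < +oo]%E)%E ->
  exists N, (0 < P (lil_event N))%E.
Proof.
set E := [set w | _] => PE; apply: contrapT => noN.
have P0 N : P (lil_event N) = 0%E.
  apply/eqP; rewrite eq_le measure_ge0 andbT leNgt; apply/negP => h.
  by apply: noN; exists N.
have EU : E = \bigcup_N lil_event N.
  have posn N (n : idx dim) : (forall i, (N < n i)%N) -> 0 < lil_norm R n.
    by move=> Nn; apply: lil_norm_gt0 => // i; rewrite (leq_ltn_trans _ (Nn i)).
  apply/seteqP; split => [w /limsup_along_infty_lty[N hN]|w [N _ hN]].
    exists N => // n Nn; rewrite -ler_pdivrMr; first exact: hN.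
    exact: posn Nn.
  apply/limsup_along_infty_lty; exists N => n Nn.
  rewrite ler_pdivrMr; first exact: hN.
  exact: posn Nn.
have : P.-negligible (\bigcup_N lil_event N).
  apply: negligible_bigcup => N; exists (lil_event N).
  by split; [exact: measurable_lil_event|exact: P0|].
rewrite -EU => /measure_negligible PE0; move: PE; rewrite PE0 ?ltxx//.
by rewrite EU; apply: bigcupT_measurable => N; exact: measurable_lil_event.
Qed.

(** Coordinates above [N + 1] are required so that every corner of the unit cube below [n] still has
    coordinates above [N]; the cube has [2 ^ dim] corners. *)
Lemma lil_event_increment N w (n : idx dim) :
  lil_event N w -> (forall i, (N.+1 < n i)%N) ->
  `|X n w| <= 2 ^+ dim * N%:R * lil_norm R n.
Proof.
move=> wN Nn; rewrite -mulrA.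
apply: (@norm_mixed_difference_le dim R T (fun k w => X k w)) => [i|J].
  by rewrite (leq_trans _ (Nn i)).
apply: (@le_trans _ _ (N%:R * lil_norm R (corner n J))).
  apply: wN => i; rewrite ffunE; have := Nn i.
  by case: (i \in J); rewrite ?subn0 ?subn1; [case: (n i)|move/ltnW].
rewrite ler_wpM2l// le_lil_norm// => i.
by rewrite ffunE leq_subr.
Qed.

Lemma shift_idx_inj N L : injective (@shift_idx dim N L).
Proof.
move=> k l /ffunP kl; apply/ffunP => i; apply/val_inj.
by have := kl i; rewrite !ffunE => -[] /addIn.
Qed.

(** Integrates [lil_moment_le_count] at [|X1|]: the counted indicators integrate to tail
    probabilities, whose sum is at most [2 / p] whatever the box. *)
Lemma integral_lil_moment_le N : (0 < P (lil_event N))%E ->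
  exists b : R, (\int[P]_w (lil_moment dim `|X1 w|)%:E <= b%:E)%E.
Proof.
move=> PN; have mN := measurable_lil_event N.
pose p := fine (P (lil_event N)).
have pE : P (lil_event N) = p%:E by rewrite fineK// fin_num_measure.
have p0 : 0 < p by rewrite -lte_fin -pE.
pose K : R := 2 ^+ dim * N%:R.
have K0 : 0 <= K by rewrite mulr_ge0// exprn_ge0.
have [c0 [c1 [c0_0 c1_0 hc]]] := lil_moment_le_count N.+1 dim_gt0 K0.
exists (c0 + c1 * (2 / p)).
have mX1 : measurable_fun setT (fun w => `|X1 w|) by apply: measurableT_comp.
have mg : measurable_fun setT (fun w => lil_moment dim `|X1 w|).
  by apply: (measurableT_comp (@measurable_lil_moment R dim)).
apply: (@integral_le_of_trunc _ _ _ _ _ X1) => // [w|J]; first exact: lil_moment_ge0.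
have [L hL] := hc J.
pose t (m : {ffun 'I_dim -> 'I_L}) : R := K * lil_norm R (shift_idx N.+1 m).
have t0 n : 0 <= K * lil_norm R n by rewrite mulr_ge0// sqrtr_ge0.
pose B m := [set w | t m < `|X1 w|].
have mB m : measurable (B m).
  rewrite /B norm_gtE; last exact: t0.
  by apply: measurableU; [exact: measurable_X_gt|exact: measurable_X_lt].
have mI m : measurable_fun setT (fun w => (\1_(B m) w)%:E : \bar R).
  by apply/measurable_EFinP/measurable_indic.
have I0 m w : setT w -> (0 <= (\1_(B m) w)%:E :> \bar R)%E by rewrite lee_fin.
have sumB : (\sum_m P (B m) <= (2 / p)%:E)%E.
  have h : (P (lil_event N) * \sum_(n <-
      [seq shift_idx N.+1 m | m : {ffun 'I_dim -> 'I_L}])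
      P [set w | (K * lil_norm R n < `|X n w|)%R] <= 2%:E)%E.
    apply: prob_mul_sum_tail_le2 => //.
    - by rewrite map_inj_uniq ?enum_uniq//; exact: shift_idx_inj.
    - by move=> n /mapP[m _ ->] i; rewrite ffunE.
    - move=> w n wN /mapP[m _ ->]; apply: lil_event_increment => // i.
      by rewrite ffunE ltnS leq_addl.
  rewrite mulrC EFinM lee_pdivlMl// -pE; apply: le_trans h.
  rewrite big_image/= le_eqVlt; apply/orP; left; apply/eqP; congr (_ * _)%E.
  apply: eq_bigr => m _.
  (* The tails of the different variables become tails of [X1] by equality in law. *)
  have pm : pos_idx (shift_idx N.+1 m) by move=> i; rewrite ffunE.
  have mnt : measurable [set x : R | t m < `|x|].
    rewrite [X in measurable X](_ : _ =
      [set: R] `&` (fun x : R => `|x|) @^-1` `]t m, +oo[).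
      have mn : measurable_fun [set: R] (fun x : R => `|x|) by exact: normr_measurable.
      exact: mn.
    by rewrite setTI; apply/seteqP; split => x /=; rewrite in_itv/= andbT.
  by have := same_distribution_one pm mnt; rewrite /distribution/= /pushforward => ->.
apply: (@le_trans _ _ (\int[P]_w (c0%:E + c1%:E * \sum_m (\1_(B m) w)%:E))%E).
  apply: ge0_le_integral => //.
  - by move=> w _; rewrite lee_fin mulr_ge0// lil_moment_ge0.
  - apply/measurable_EFinP; apply: measurable_funM => //.
    rewrite [X in measurable_fun _ X](_ : _ = \1_[set w | `|X1 w| <= J%:R]); last first.
      by apply/funext => w; rewrite indicE mem_setE.
    apply: measurable_indic.
    rewrite [X in measurable X](_ : _ =
      [set: T] `&` (fun w => `|X1 w|) @^-1` `]-oo, J%:R]).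
      exact: mX1.
    by rewrite setTI; apply/seteqP; split => x /=; rewrite in_itv/=.
  - apply: emeasurable_funD => //; apply: measurable_funeM.
    exact: emeasurable_sum.
  - move=> w _; rewrite sumEFin -EFinM -EFinD lee_fin.
    have [XJ|_] := boolP (`|X1 w| <= J%:R); last first.
      by rewrite mulr0 addr_ge0// mulr_ge0// sumr_ge0.
    rewrite mulr1 (le_trans (hL _ _)) ?normr_ge0 ?XJ//.
    rewrite lerD2l ler_wpM2l// ler_sum// => m _.
    by rewrite indicE mem_setE.
rewrite ge0_integralD//; last 2 first.
  - by move=> w _; rewrite mule_ge0// ?lee_fin// sume_ge0.
  - by apply: measurable_funeM; exact: emeasurable_sum.
rewrite integral_cst//= probability_setT mule1 EFinD leeD2l//.
rewrite ge0_integralZl_EFin//; last 2 first.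
  - by move=> w _; rewrite sume_ge0.
  - exact: emeasurable_sum.
rewrite EFinM lee_wpmul2l ?lee_fin// ge0_integral_sum//.
by under eq_bigr do rewrite integral_indic// setIT.
Qed.

Lemma Lfun1_X1 : (\int[P]_w (lil_moment dim `|X1 w|)%:E < +oo)%E ->
  (X1 : T -> R) \in Lfun P 1.
Proof.
move=> fin; apply/Lfun1_integrable/integrableP; split.
  by apply/measurable_EFinP.
have [x0 x0_0 hx0] := @le_lil_moment R dim 1 ltr01.
have mg : measurable_fun setT (fun w => (lil_moment dim `|X1 w|)%:E).
  apply/measurable_EFinP; apply: (measurableT_comp (@measurable_lil_moment R dim)).
  exact: measurableT_comp.
apply: (@le_lt_trans _ _ (\int[P]_w (x0%:E + (lil_moment dim `|X1 w|)%:E))%E).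
  apply: ge0_le_integral => //.
  - by apply: measurableT_comp => //; exact/measurable_EFinP.
  - exact: emeasurable_funD.
  - move=> w _; rewrite -EFinD lee_fin.
    have [h|h] := leP x0 `|X1 w|.
      by rewrite ler_wpDl ?(ltW x0_0)// (le_trans (hx0 _ h))// mul1r.
    by rewrite ler_wpDr ?lil_moment_ge0// ltW.
rewrite ge0_integralD//.
- by rewrite integral_cst//= probability_setT mule1 lte_add_pinfty// ltry.
- by move=> w _; rewrite lee_fin ltW.
- by move=> w _; rewrite lee_fin lil_moment_ge0.
Qed.

(** If the mean were nonzero, the weak law on a large cube would give [p <= p / 2 + p / 4] for the
    probability [p > 0] of [lil_event N]. *)
Lemma mean_X1_eq0 N : (0 < P (lil_event N))%E ->
  (\int[P]_w (lil_moment dim `|X1 w|)%:E < +oo)%E -> ('E_P[X1] = 0)%E.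
Proof.
move=> PN fin; have mN := measurable_lil_event N.
have X11 := Lfun1_X1 fin.
pose p := fine (P (lil_event N)).
have pE : P (lil_event N) = p%:E by rewrite fineK// fin_num_measure.
have p0 : 0 < p by rewrite -lte_fin -pE.
have p1 : p <= 1 by rewrite -lee_fin -pE probability_le1.
have int0 : (0 <= \int[P]_w (lil_moment dim `|X1 w|)%:E)%E.
  by apply: integral_ge0 => w _; rewrite lee_fin lil_moment_ge0.
pose H := fine (\int[P]_w (lil_moment dim `|X1 w|)%:E)%E.
have HE : (\int[P]_w (lil_moment dim `|X1 w|)%:E = H%:E)%E.
  by rewrite fineK// ge0_fin_numE.
have H0 : 0 <= H by exact: fine_ge0.
pose mu := fine 'E_P[X1].
suff mu0 : mu = 0 by rewrite -(fineK (expectation_fin_num X11)) -/mu mu0.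
apply/eqP; apply: contraT => mu0.
have nmu : 0 < `|mu| by rewrite normr_gt0.
(* Chosen so that the clipping error [r <= a * H] satisfies [4 * r / |mu| <= p / 4]; [H + 1] avoids
   a zero denominator. *)
pose a := `|mu| * p / (16 * (H + 1)).
have a0 : 0 < a by rewrite divr_gt0 ?mulr_gt0//; lra.
have aH : a * H <= `|mu| * p / 16.
  rewrite /a -mulrA ler_wpM2l ?mulr_ge0 ?(ltW nmu) ?(ltW p0)//.
  rewrite invfM -mulrA ler_piMr ?invr_ge0// mulrC ler_pdivrMr; lra.
have [M M0 hM] := @le_lil_moment R dim a a0.
(* Chosen so that [LogLog m <= b * m] puts [N] times the normalisation below [m * |mu| / 4]. *)
pose b := mu ^+ 2 / (16 * (2 * dim%:R * N%:R ^+ 2 + 1)).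
have dN0 : 0 <= 2 * dim%:R * N%:R ^+ 2 :> R by rewrite !mulr_ge0// exprn_ge0.
have mu2 : 0 < mu ^+ 2 by rewrite -(real_normK (num_real mu)) exprn_gt0.
have b0 : 0 < b by apply: divr_gt0 => //; lra.
have bE : b * (2 * dim%:R * N%:R ^+ 2 + 1) = mu ^+ 2 / 16.
  by rewrite /b; field; rewrite gt_eqF//; lra.
have [x0 x0_1 hx0] := LogLog_le_linear b0.
(* The side of the cube: the three summands ensure [x0 <= m], a Chebyshev term below [p / 2], and
   coordinates above [N]. *)
pose k := ((Num.truncn x0 + Num.truncn (32 * M ^+ 2 / (p * mu ^+ 2)) + N).+1)%N.
pose n : idx dim := [ffun=> k].
have n0 : pos_idx n by move=> i; rewrite ffunE.
pose m : R := (idx_card n)%:R.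
have km : k%:R <= m.
  rewrite ler_nat /idx_card; under eq_bigr do rewrite ffunE.
  by rewrite prod_nat_const card_ord -[X in (X <= _)%N]expn1 leq_pexp2l.
have x0m : x0 <= m.
  apply: le_trans km; apply: ltW; apply: lt_le_trans (truncnS_gt _) _.
  by rewrite ler_nat ltnS -addnA leq_addr.
have Mm : 32 * M ^+ 2 / (p * mu ^+ 2) < m.
  apply: lt_le_trans km; apply: lt_le_trans (truncnS_gt _) _.
  by rewrite ler_nat ltnS addnAC leq_addl.
have m0 : 0 < m by lra.
pose r := fine (\int[P]_w (`|X1 w - clip M (X1 w)|)%:E)%E.
have raH : r <= a * H.
  have h : (\int[P]_w (`|X1 w - clip M (X1 w)|)%:E <= (a * H)%:E)%E.
    rewrite EFinM -HE -ge0_integralZl_EFin//; last 3 first.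
    - by move=> w _; rewrite lee_fin lil_moment_ge0.
    - apply/measurable_EFinP; apply: (measurableT_comp (@measurable_lil_moment R dim)).
      exact: measurableT_comp.
    - exact: ltW.
    apply: ge0_le_integral => //.
    - apply/measurable_EFinP; apply: measurableT_comp => //.
      apply: measurable_funB => //.
      by apply: measurableT_comp => //; exact: measurable_clip.
    - apply: measurable_funeM; apply/measurable_EFinP.
      apply: (measurableT_comp (@measurable_lil_moment R dim)).
      exact: measurableT_comp.
    - move=> w _; rewrite -EFinM lee_fin (le_trans (norm_sub_clip_le _ (ltW M0)))//.
      have [Mx|_] := ltP M `|X1 w|; first by rewrite mulr1 hM// ltW.
      by rewrite mulr0 mulr_ge0 ?lil_moment_ge0// ltW.
  rewrite -lee_fin; apply: le_trans (h); rewrite fineK// ge0_fin_numE.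
    by apply: le_lt_trans h _; rewrite ltry.
  by apply: integral_ge0.
have rmu : r <= `|mu| / 4 by nra.
have sizeE : (size (box_seq n))%:R = m :> R by rewrite size_box_seq.
have clip2 j : clip M \o X j \in Lfun P 2%:E.
  apply: (@bounded_Lfun2 _ _ _ _ _ M) => [|w]; last by apply: norm_clip_le; exact: ltW.
  by apply: measurableT_comp => //; exact: measurable_clip.
have := @weak_law_bound _ _ _ P _ (box_seq n) X X1 (lil_event N) M (box_seq_uniq n).
rewrite sizeE -/mu -/r -/p size_box_seq => h.
suff : p <= 16 * M ^+ 2 / (m * mu ^+ 2) + 4 * r / `|mu|.
  have h1 : 16 * M ^+ 2 / (m * mu ^+ 2) < p / 2.
    rewrite ltr_pdivrMr ?(mulr_gt0 m0 mu2)//; move: Mm.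
    by rewrite ltr_pdivrMr ?(mulr_gt0 p0 mu2)//; lra.
  have h2 : 4 * r / `|mu| <= p / 4.
    by rewrite ler_pdivrMr//; lra.
  by lra.
apply: h => //.
- exact: idx_card_gt0.
- by move=> j /box_seq_pos; exact: same_distribution_one.
- exact: ltW.
- move=> i j /box_seq_pos i0 /box_seq_pos j0 ij.
  by apply: na_covariance_le0 => //; exact: clip_homo.
- move=> w wN; rewrite -(partial_sumE (fun k w => X k w)).
  apply: le_lt_trans (wN n _) _.
    by move=> i; rewrite ffunE /k ltnS leq_addl.
  apply: lil_norm_lt => //; first by rewrite divr_gt0 ?mulr_gt0.
  rewrite -/m expr_div_n exprMn (real_normK (num_real mu)).
  apply: (@le_lt_trans _ _ (2 * dim%:R * N%:R ^+ 2 * (m * (b * m)))).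
    by rewrite ler_wpM2l// ler_wpM2l ?(ltW m0)// hx0.
  have -> : 2 * dim%:R * N%:R ^+ 2 * (m * (b * m)) =
      (b * (2 * dim%:R * N%:R ^+ 2 + 1) - b) * m ^+ 2 by ring.
  rewrite bE; have := mulr_gt0 b0 (exprn_gt0 2 m0); lra.
Qed.

End Field.

Theorem theorem1p3 (d0 : measure_display) (T : measurableType d0)
    (R : realType) (P : probability T R) (dim : nat) (hdim : (1 <= dim)%N)
    (X : idx dim -> {RV P >-> R}) :
  negatively_associated X ->
  identically_distributed X ->
  (0 < P [set w | limsup_along
          (fun n : idx dim =>
             ((`|partial_sum (fun k w => X k w) n w|
               / Num.sqrt (2 * dim%:R * (idx_card n)%:R
                           * LogLog ((idx_card n)%:R)))%:E))
          (@idx_to_infty dim) < +oo]%E)%E ->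
  (X (one_idx dim) : T -> R) \in Lfun P 1 /\
  ('E_P[X (one_idx dim)] = 0)%E /\
  ('E_P[(fun w => X (one_idx dim) w ^+ 2
                 * Log `|X (one_idx dim) w| ^+ (dim - 1)
                 / LogLog `|X (one_idx dim) w|)%R] < +oo)%E.
Proof.
move=> na idd /(lil_event_gt0 hdim)[N PN].
have [b hb] := integral_lil_moment_le hdim na idd PN.
have fin : (\int[P]_w (lil_moment dim `|X (one_idx dim) w|)%:E < +oo)%E.
  by rewrite (le_lt_trans hb)// ltry.
split; first exact: Lfun1_X1 fin.
split; first exact: mean_X1_eq0 hdim na idd _ PN fin.
rewrite unlock; apply: le_lt_trans fin; rewrite le_eqVlt; apply/orP; left; apply/eqP.
apply: eq_integral => w _; rewrite /lil_moment.
by rewrite (real_normK (num_real _)).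
Qed.
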